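(* Let $f(x)=a_nx^n+\dots+a_0$ be a polynomial of degree $n$ with integer coefficients and let $q$ be an odd prime. Suppose $a_0\not\equiv 0\pmod q$, that the congruence $f(x)\equiv 0\pmod q$ has $\ell$ solutions in $\mathbb{Z}_q$, and that exactly $b$ of these solutions are quadratic residues modulo $q$. Then $$R\bigl(f(x),x^{\frac{q-1}{2}}-1\bigr)= a_n^{\frac{q-1}{2}}\prod_{i=1}^n\bigl(\alpha_i^{\frac{q-1}{2}}-1\bigr)\equiv 0\pmod{q^{b}}$$ and $$R\bigl(f(x),x^{\frac{q-1}{2}}+1\bigr)= a_n^{\frac{q-1}{2}}\prod_{i=1}^n\bigl(\alpha_i^{\frac{q-1}{2}}+1\bigr)\equiv 0\pmod{q^{\ell-b}},$$ where $\alpha_1,\dots,\alpha_n$ are the complex roots of $f(x)$, each repeated according to its multiplicity.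
   Context: For $f(x)=\sum_{i=0}^n a_i x^i$ and $g(x)=\sum_{j=0}^m b_j x^j$ of degrees $n$ and $m$, the resultant $R(f,g)$ is the determinant of the Sylvester matrix; equivalently $R(f,g)=a_n^m\prod_{i=1}^n g(\alpha_i)$, where $\alpha_i$ are the roots of $f$ with multiplicity. *)

(* Defs.v *)
From HB Require Import structures.
From mathcomp Require Import all_boot all_order all_algebra perm.
From mathcomp Require Import reals complex zify.

Set Implicit Arguments.
Unset Strict Implicit.
Unset Printing Implicit Defensive.

Import Order.TTheory GRing.Theory Num.Theory.
Local Open Scope ring_scope.

(* With n = deg f and m = deg g, the (m + n) x (m + n) Sylvester matrix with
   coefficients in decreasing order: m shifted rows a_n ... a_0 followed by
   n shifted rows b_m ... b_0.  mathcomp's Sylvester_mx lists coefficients in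
   increasing order, so that its resultant f g is (-1) ^+ (m * n) times the
   one below, i.e. mathcomp's resultant g f (lemma resE). *)
Definition sylvester (A : comNzRingType) (f g : {poly A}) :
    'M[A]_((size g).-1 + (size f).-1) :=
  let n := (size f).-1 in let m := (size g).-1 in
  \matrix_(i, j)
    match split i with
    | inl k => if (k <= j <= k + n)%N then f`_(n + k - j) else 0
    | inr k => if (k <= j <= k + m)%N then g`_(m + k - j) else 0
    end.

Definition res (A : comNzRingType) (f g : {poly A}) : A := \det (sylvester f g).

Lemma resE (A : comNzRingType) (f g : {poly A}) : res f g = resultant g f.
Proof.
rewrite /res /resultant.
set n := (size f).-1; set m := (size g).-1.
have h : (n + m = m + n)%N by rewrite addnC.
transitivity (\det (castmx (h, h) (Sylvester_mx g f))); last first.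
  by case: _ / h.
pose s := perm (@rev_ord_inj (m + n)).
transitivity (\det (row_perm s (col_perm s (castmx (h, h) (Sylvester_mx g f))))).
  congr (\det _); apply/matrixP => i j; rewrite !mxE castmxE Sylvester_mxE !permE -/n -/m.
  have lt_j := ltn_ord j.
  case: (splitP i) => k Ek; case: splitP => l /= El;
    have lt_k := ltn_ord k; have lt_l := ltn_ord l; rewrite /= Ek in El.
  - by exfalso; move: El lt_k lt_l lt_j; rewrite -/n -/m; lia.
  - have -> : (l <= m + n - j.+1)%N = (j <= k + n)%N.
      by move: El lt_k lt_l lt_j; rewrite -/n -/m; lia.
    have -> : (m + n - j.+1 - l = n + k - j)%N.
      by move: El lt_k lt_l lt_j; rewrite -/n -/m; lia.
    case: (leqP j (k + n)) => _; rewrite ?andbF ?mulr0n // andbT mulr1n.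
    case: leqP => // lt_jk; rewrite nth_default //.
    by apply: leq_trans (leqSpred _) _; move: lt_jk; rewrite -/n; lia.
  - have -> : (l <= m + n - j.+1)%N = (j <= k + m)%N.
      by move: El lt_k lt_l lt_j; rewrite -/n -/m; lia.
    have -> : (m + n - j.+1 - l = m + k - j)%N.
      by move: El lt_k lt_l lt_j; rewrite -/n -/m; lia.
    case: (leqP j (k + m)) => _; rewrite ?andbF ?mulr0n // andbT mulr1n.
    case: leqP => // lt_jk; rewrite nth_default //.
    by apply: leq_trans (leqSpred _) _; move: lt_jk; rewrite -/m; lia.
  - by exfalso; move: El lt_k lt_l lt_j; rewrite -/n -/m; lia.
rewrite row_permE col_permE !det_mulmx !det_perm mulrCA -signr_addb.
by rewrite odd_permV addbb expr0 mulr1.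
Qed.

Definition roots_with_multiplicity (F : fieldType) (n : nat) (p : {poly F})
    (alpha : 'I_n -> F) : Prop :=
  forall z : F, #|[set i | alpha i == z]| = mup z p.

(* The reduction of f modulo q is the image of f in {poly 'F_q}; 'F_q is Z/qZ
   only for q prime. *)
Definition solutions_mod (q : nat) (f : {poly int}) : {set 'F_q} :=
  [set x | root (map_poly intr f) x].

Definition quadratic_residue (q : nat) (x : 'F_q) : bool :=
  (x != 0) && [exists y : 'F_q, y ^+ 2 == x].

(* Main.v *)
(* The Sylvester matrix S of g and f maps the Vandermonde column of a point x to
   the values x^i g(x) and x^i f(x).  Over the complex numbers, completing the
   Vandermonde matrix of the (distinct, nonzero) roots of g = X^m - c to a square
   matrix makes the product with S block triangular, which gives the resultant as
   a product of values of f at the roots of g.  Over F_q, the Vandermonde columns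
   of the b distinct common roots of f and g lie in the kernel of S; lifting them
   to the integers shows that q^b divides det S.  By Euler's criterion every root
   of f in F_q is nonzero, hence a root of X^m - 1 or of X^m + 1 according to
   whether it is a quadratic residue. *)
Require Import Defs.
From mathcomp Require Import all_boot all_order all_fingroup all_algebra all_field cyclic.
From mathcomp Require Import reals complex.
From mathcomp Require Import ring zify.

Import Order.TTheory GRing.Theory Num.Theory.
Local Open Scope ring_scope.

Set Implicit Arguments.
Unset Strict Implicit.
Unset Printing Implicit Defensive.

(** The rows of the Sylvester matrix hold the coefficients of ['X^i * p], then of ['X^i * q], so a
    column of powers of a point evaluates them there. The morphism [phi] lets integer polynomials be
    evaluated both in the complex numbers and in ['F_q]. *)
Lemma map_Sylvester_Vandermonde (A B : comNzRingType) (phi : {rmorphism A -> B})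
    (p q : {poly A}) (k : nat) (a : 'rV[B]_k) :
  map_mx phi (Sylvester_mx p q) *m Vandermonde _ a =
  col_mx (\matrix_(i, j) (a 0 j ^+ i * (map_poly phi p).[a 0 j]))
         (\matrix_(i, j) (a 0 j ^+ i * (map_poly phi q).[a 0 j])).
Proof.
have band (r : {poly A}) (N d : nat) (sz : (d + (size r).-1 <= N)%N)
    (i : 'I_d) (x : B) :
    \sum_(j < N) phi (('X^i * r)`_j) * x ^+ j = x ^+ i * (map_poly phi r).[x].
  transitivity ((map_poly phi ('X^i * r)).[x]); last first.
    by rewrite rmorphM /= map_polyXn !hornerE ?hornerXn.
  rewrite (@horner_coef_wide _ N); first by apply: eq_bigr => j _; rewrite coef_map.
  apply: leq_trans (size_poly _ _) _; rewrite -commr_polyXn.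
  have [->|r0] := eqVneq r 0; first by rewrite mul0r size_poly0.
  rewrite size_mulXn //; apply: leq_trans sz.
  by move: (ltn_ord i); rewrite -[size r]prednK ?size_poly_gt0 // addnS ltn_add2r.
rewrite /Sylvester_mx map_col_mx mul_col_mx; congr col_mx;
  apply/matrixP=> i j; rewrite !mxE.
  rewrite -(@band p ((size q).-1 + (size p).-1)%N) //.
  by apply: eq_bigr => l _; rewrite !mxE /= rVpoly_delta.
rewrite -(@band q ((size q).-1 + (size p).-1)%N) 1?addnC //.
by apply: eq_bigr => l _; rewrite !mxE /= rVpoly_delta.
Qed.

Lemma resultant_prod_roots (A : comNzRingType) (F : idomainType)
    (phi : {rmorphism A -> F}) (p q : {poly A}) (rs : seq F) :
    map_poly phi p = \prod_(z <- rs) ('X - z%:P) -> (size p).-1 = size rs ->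
    uniq rs -> 0 \notin rs ->
  phi (resultant p q) =
    (-1) ^+ (size rs * (size q).-1) * \prod_(z <- rs) (map_poly phi q).[z].
Proof.
move=> def_p sz_p Urs rs0.
pose n := (size q).-1; pose m := (size p).-1.
pose a : 'rV[F]_m := \row_j rs`_j.
have prod_a (h : F -> F) : \prod_(z <- rs) h z = \prod_j h (a 0 j).
  rewrite (big_nth 0) big_mkord -sz_p; apply: eq_bigr => j _; by rewrite mxE.
pose V := Vandermonde m a.
(* M completes the Vandermonde columns on the left, because p(0) then appears on
   the diagonal of the upper left block of S *m M and cancels against det M. *)
pose M := block_mx 1%:M (Vandermonde n a) 0
            (\matrix_(i, j) a 0 j ^+ (n + i)) : 'M[F]_(n + m).
have detM : \det M = \det V * \prod_j (a 0 j) ^+ n.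
  rewrite det_ublock det1 mul1r.
  have -> : (\matrix_(i < m, j < m) a 0 j ^+ (n + i))
            = V *m diag_mx (\row_j a 0 j ^+ n).
    by apply/matrixP=> i j; rewrite mul_mx_diag !mxE -exprD addnC.
  by rewrite det_mulmx det_diag; congr (_ * _); apply: eq_bigr => j _; rewrite mxE.
have defM : M = row_mx (col_mx 1%:M 0) (Vandermonde (n + m) a).
  rewrite /M block_mxEh; congr row_mx; apply/matrixP=> i j.
  by rewrite -(splitK i); case: (split i) => k /=; rewrite ?col_mxEu ?col_mxEd !mxE.
pose S := map_mx phi (Sylvester_mx p q).
have : S *m M = block_mx (ulsubmx S) 0 (dlsubmx S)
                   (V *m diag_mx (\row_j (map_poly phi q).[a 0 j])).
  rewrite defM mul_mx_row map_Sylvester_Vandermonde block_mxEh; congr row_mx.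
    rewrite -[S in LHS]submxK mul_block_col !mulmx1 !mulmx0 !addr0.
    by rewrite /ulsubmx /dlsubmx.
  congr col_mx; apply/matrixP=> i j; rewrite ?mul_mx_diag !mxE //.
  rewrite def_p (_ : _.[_] = 0) ?mulr0 //; apply/rootP; rewrite root_prod_XsubC.
  by rewrite mem_nth // -sz_p.
move/(congr1 determinant); rewrite det_mulmx det_lblock det_mulmx det_diag detM.
have ulS i j : ulsubmx S i j = (map_poly phi p)`_(j - i) *+ (i <= j)%N.
  rewrite mxE [usubmx _ _ _]mxE [S _ _]mxE Sylvester_mxE -[lshift m i]/(unsplit (inl i)).
  by rewrite unsplitK rmorphMn /= coef_map.
have p0 : (map_poly phi p)`_0 = \prod_j (- a 0 j).
  rewrite -horner_coef0 def_p horner_prod -(prod_a -%R).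
  by apply: eq_bigr => z _; rewrite !hornerE.
have -> : \det (ulsubmx S) = (\prod_j (- a 0 j)) ^+ n.
  (* Row [i] of this block is zero before column [i], so the block is upper triangular, whereas
     [det_trig] expects a lower triangular matrix. *)
  rewrite -det_tr det_trig; last first.
    by apply/is_trig_mxP=> i j ltij; rewrite mxE ulS leqNgt ltij mulr0n.
  rewrite -[n in RHS]card_ord -prodr_const; apply: eq_bigr => i _.
  by rewrite mxE ulS subnn leqnn p0.
(* Distinct roots make [\det V] nonzero and [0 \notin rs] does the same for the product of powers,
   so [\det M] cancels; of the upper left block only a sign is left. *)
have V0 : \det V != 0.
  rewrite det_Vandermonde; apply/prodf_neq0 => i _; apply/prodf_neq0 => j ltij.
  by rewrite subr_eq0 !mxE nth_uniq -?sz_p // gtn_eqF.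
have a0 : \prod_j a 0 j ^+ n != 0.
  apply/prodf_neq0 => j _; rewrite expf_neq0 // mxE.
  by apply: contraNneq rs0 => <-; rewrite mem_nth // -sz_p.
rewrite det_map_mx [X in _ = _ * (_ * X)](eq_bigr (fun j => (map_poly phi q).[a 0 j]));
  last by move=> j _; rewrite !mxE.
rewrite prod_a -sz_p -/m => eqdet; apply: (mulIf (mulf_neq0 V0 a0)).
rewrite eqdet prodrN card_ord exprMn -exprM prodrXl; ring.
Qed.

(** Integer lifts of the kernel columns, completed by unit vectors, form a matrix [M]. Modulo [q],
    [\det M] is the [b] by [b] Vandermonde determinant of distinct points, hence nonzero, while the
    first [b] columns of [S *m M] are divisible by [q]. *)
Lemma dvdz_det_ker (q : nat) (N b : nat) (S : 'M[int]_N) (x : 'rV['F_q]_b) :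
    prime q -> injective (x 0) -> (b <= N)%N ->
    map_mx intr S *m Vandermonde N x = 0 ->
  (q%:Z ^+ b %| \det S)%Z.
Proof.
move=> q_pr inj_x /subnKC; move: (N - b)%N => k defN; case: N / defN S => S Sx.
have Fp_dvd (z : int) : ((z%:~R : 'F_q) == 0) = (q%:Z %| z)%Z.
  by rewrite (dvdz_pcharf (pchar_Fp q_pr)).
pose V := map_mx (fun y : 'F_q => (y : nat)%:Z) (Vandermonde (b + k) x).
have VE : map_mx intr V = Vandermonde (b + k) x.
  by apply/matrixP=> i j; rewrite !mxE -pmulrn natr_Zp.
pose W := map_mx (fun z => z %/ q%:Z)%Z (S *m V).
have SV : S *m V = W *m (q%:Z)%:M.
  apply/matrixP=> i j; rewrite mul_mx_scalar !mxE mulrC divzK // -Fp_dvd.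
  have /matrixP/(_ i j) := Sx; rewrite -VE -map_mxM mxE [in RHS]mxE => /eqP.
  by rewrite [(S *m V) i j]mxE.
pose M := row_mx V (col_mx 0 1%:M) : 'M_(b + k).
have detM : coprimez (q%:Z ^+ b) (\det M).
  have -> : \det M = \det (usubmx V).
    by rewrite /M -[V in LHS]vsubmxK -block_mxEh det_lblock det1 mulr1.
  apply: coprimezXl; rewrite coprimezE prime_coprime // -dvdzE -Fp_dvd -det_map_mx.
  rewrite map_usubmx VE (_ : usubmx _ = Vandermonde b x); last first.
    by apply/matrixP=> i j; rewrite !mxE.
  rewrite det_Vandermonde; apply/prodf_neq0 => i _; apply/prodf_neq0 => j ltij.
  by rewrite subr_eq0 (inj_eq inj_x) -val_eqE gtn_eqF.
rewrite -(Gauss_dvdzl _ detM) -det_mulmx.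
have -> : S *m M = row_mx W (S *m col_mx 0 1%:M) *m block_mx (q%:Z)%:M 0 0 1%:M.
  by rewrite mul_mx_row mul_row_block !mulmx0 mulmx1 addr0 add0r SV.
by rewrite det_mulmx det_ublock det_scalar det1 mulr1 dvdz_mull.
Qed.

(** With [u] a generator of the unit group, [u ^+ m = -1], so [x = u ^+ k] gives
    [x ^+ m = (-1) ^+ k]; an even [k] would make [x] a square. *)
Lemma euler_criterion (q : nat) (x : 'F_q) : prime q -> odd q -> x != 0 ->
  x ^+ ((q - 1) %/ 2) = if quadratic_residue x then 1 else -1.
Proof.
move=> q_pr q_odd x0; set m := (_ %/ 2)%N.
rewrite /quadratic_residue x0 /=.
have cardF : #|{: 'F_q}| = (2 * m).+1.
  rewrite card_Fp // /m; have := prime_gt0 q_pr; have := odd_double_half q; rewrite q_odd.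
  by move=> <- _; rewrite add1n subn1 /= -muln2 mulnK // mulnC.
have exp2m (y : 'F_q) : y != 0 -> y ^+ (2 * m) = 1.
  move=> y0; apply: (mulIf y0); rewrite -exprSr -cardF expf_card mul1r //.
have /cyclicP[u genu] : cyclic [set: {unit 'F_q}] by apply: field_unit_group_cyclic.
(* As [u] has order [2 * m], its power [u ^+ m] is a square root of 1 other than 1. *)
have um : (val u) ^+ m = -1.
  have /eqP : (val u ^+ m) ^+ 2 = 1 by rewrite -exprM mulnC exp2m // -unitfE (valP u).
  rewrite sqrf_eq1 => /orP[/eqP um1|/eqP //].
  have : (#[u]%g %| m)%N.
    by rewrite order_dvdn; apply/eqP; apply: val_inj; rewrite FinRing.val_unitX.
  rewrite /order -genu card_finField_unit cardF /= => /dvdn_leq.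
  by have := finNzRing_gt1 'F_q; rewrite cardF; lia.
have [k xk] : exists k, x = (val u) ^+ k.
  have ux : x \is a GRing.unit by rewrite unitfE.
  have : Sub x ux \in <[u]>%g by rewrite -genu inE.
  case/cycleP=> k /(congr1 val) xk; exists k.
  by move: xk; rewrite FinRing.val_unitX.
case: existsP => [[y /eqP y2x]|nres].
  rewrite -y2x -exprM exp2m //; apply: contraNneq x0 => y0.
  by rewrite -y2x y0 expr0n.
rewrite xk exprAC um -signr_odd; have [//|] := boolP (odd k) => evk.
case: nres; exists (val u ^+ k./2); rewrite -exprM muln2 xk.
by rewrite -[k in X in _ == X]odd_double_half (negPf evk).
Qed.

Lemma dvdz_resultant_common_roots (q : nat) (f g : {poly int}) (B : {set 'F_q}) :
    prime q -> map_poly intr g != 0 :> {poly 'F_q} ->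
    {in B, forall x, root (map_poly intr f) x && root (map_poly intr g) x} ->
  (q%:Z ^+ #|B| %| resultant g f)%Z.
Proof.
move=> q_pr g0 fgB; pose x : 'rV['F_q]_#|B| := \row_i enum_val i.
apply: (@dvdz_det_ker q _ _ _ x) => //.
- by move=> i j; rewrite !mxE => /enum_val_inj.
(* Being nonzero modulo [q], [g] has at most as many roots there as its degree, which is one of the
   two summands of the matrix size. *)
- apply: leq_trans (leq_addl _ _); rewrite cardE.
  have roots_g : all (root (map_poly (intr : int -> 'F_q) g)) (enum B).
    by apply/allP=> y; rewrite mem_enum => /fgB/andP[].
  have := leq_trans (max_poly_roots g0 roots_g (enum_uniq B)) (size_poly _ _).
  by case: (size g).
- rewrite map_Sylvester_Vandermonde -[RHS]col_mx0; congr col_mx; apply/matrixP=> i j;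
    by have /andP[/rootP f0 /rootP g0'] := fgB _ (enum_valP j); rewrite !mxE ?f0 ?g0' mulr0.
Qed.

Lemma poly_roots_with_multiplicity (K : closedFieldType) (n : nat) (p : {poly K})
    (alpha : 'I_n -> K) : p != 0 -> roots_with_multiplicity p alpha ->
  p = lead_coef p *: \prod_i ('X - (alpha i)%:P).
Proof.
move=> p0 p_roots; have [rs def_p] := closed_field_poly_normal p.
have lc0 : lead_coef p != 0 by rewrite lead_coef_eq0.
rewrite {1}def_p; congr (_ *: _).
(* Both [rs] and the values of [alpha] list each [z] as often as its multiplicity in [p], so they
   agree up to order. *)
rewrite (perm_big (codom alpha)) /=; first by rewrite big_map big_enum.
apply/allP=> z _; rewrite /= -mu_prod_XsubC -(mupMr (q1 := (lead_coef p)%:P)).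
  by rewrite mul_polyC -def_p -p_roots cardsE cardE size_filter /codom count_map enumT.
by rewrite rootC.
Qed.

(** The product of [f] over the roots of [g] becomes, on factoring [f] and exchanging products, a
    product of values of [g] at the [alpha i]. Each exchange costs [(-1) ^+ m]; the [n] of them
    cancel the sign in [resultant_prod_roots]. *)
Lemma res_XnsubC (K : numClosedFieldType) (n m : nat) (c : int) (f : {poly int})
    (alpha : 'I_n -> K) :
    size f = n.+1 -> (0 < m)%N -> c != 0 ->
    roots_with_multiplicity (map_poly intr f) alpha ->
  (res f ('X^m - c%:P))%:~R = (f`_n)%:~R ^+ m * \prod_i (alpha i ^+ m - c%:~R).
Proof.
move=> f_deg m0 c0 f_roots; pose g : {poly K} := 'X^m - (c%:~R)%:P.
have mapg : map_poly intr ('X^m - c%:P) = g.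
  by rewrite rmorphB /= map_polyXn map_polyC.
have cK0 : c%:~R != 0 :> K by rewrite intr_eq0.
have [rs] := closed_field_poly_normal g.
rewrite lead_coefXnsubC // scale1r => def_g.
have sz_rs : size rs = m.
  by have := size_XnsubC (c%:~R : K) m0; rewrite -/g def_g size_prod_XsubC => -[].
have rs0 : 0 \notin rs.
  by rewrite -root_prod_XsubC -def_g rootE !hornerE expr0n (gtn_eqF m0) sub0r oppr_eq0.
have Urs : uniq rs.
  (* The roots are distinct: modulo ['X^m.-1], which is the derivative up to the nonzero scalar [m],
     [g] reduces to the nonzero constant [-c]. *)
  rewrite -separable_prod_XsubC -def_g unlock derivB derivXn derivC subr0.
  rewrite -scaler_nat coprimepZr ?pnatr_eq0 ?gtn_eqF // coprimep_sym.
  rewrite /g -[in 'X^m](prednK m0) exprS -polyCN coprimep_addl_mul.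
  by rewrite -alg_polyC coprimepZr ?coprimep1 // oppr_eq0.
have lcf : lead_coef (map_poly intr f : {poly K}) = (f`_n)%:~R.
  by rewrite lead_coef_map_inj ?rmorph0 //; [rewrite lead_coefE f_deg | exact: intr_inj].
have def_f : map_poly intr f = (f`_n)%:~R *: \prod_i ('X - (alpha i)%:P).
  rewrite -lcf; apply: poly_roots_with_multiplicity f_roots.
  rewrite -lead_coef_eq0 lcf intr_eq0 -[n]/(n.+1.-1) -f_deg -lead_coefE lead_coef_eq0.
  by rewrite -size_poly_eq0 f_deg.
have sz_g : (size ('X^m - c%:P : {poly int})).-1 = size rs.
  by rewrite size_XnsubC ?sz_rs.
rewrite resE (resultant_prod_roots f (etrans mapg def_g) sz_g Urs rs0).
rewrite f_deg sz_rs def_f /=.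
under eq_bigr => z _ do rewrite hornerZ horner_prod.
rewrite big_split /= big_const_seq count_predT iter_mulr_1 sz_rs exchange_big /=.
rewrite mulrCA; congr (_ * _).
under eq_bigr => i _.
  rewrite (_ : \prod_(_ <- _) _ = (-1) ^+ m * (alpha i ^+ m - c%:~R)); last first.
    have -> : alpha i ^+ m - c%:~R = g.[alpha i] by rewrite !hornerE.
    rewrite def_g horner_prod -{}sz_rs -count_predT -[(-1) ^+ _]iter_mulr_1.
    rewrite -big_const_seq -big_split /=; apply: eq_bigr => z _.
    by rewrite !hornerE mulN1r opprB.
  over.
by rewrite big_split /= prodr_const card_ord -exprM mulrA -exprD addnn -signr_odd odd_double mul1r.
Qed.

Theorem theorem3 (R : realType) (n q l b : nat) (f : {poly int})
    (alpha : 'I_n -> R[i])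
    (f_deg : size f = n.+1)
    (q_prime : prime q) (q_odd : odd q)
    (f0 : (f`_0 != 0 %[mod q%:Z])%Z)
    (f_sols : #|solutions_mod q f| = l)
    (f_res_sols : #|[set x in solutions_mod q f | quadratic_residue x]| = b)
    (f_roots : roots_with_multiplicity (map_poly intr f) alpha) :
  let m := ((q - 1) %/ 2)%N in
  [/\ (res f ('X^m - 1))%:~R
        = (f`_n)%:~R ^+ m * \prod_(i < n) (alpha i ^+ m - 1),
      (res f ('X^m - 1) = 0 %[mod q%:Z ^+ b])%Z,
      (res f ('X^m + 1))%:~R
        = (f`_n)%:~R ^+ m * \prod_(i < n) (alpha i ^+ m + 1)
    & (res f ('X^m + 1) = 0 %[mod q%:Z ^+ (l - b)])%Z].
Proof.
move=> m; have m0 : (0 < m)%N.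
  by rewrite divn_gt0 //; have := prime_gt1 q_prime; case: (q) q_odd => [|[|[|]]].
set S := solutions_mod q f in f_sols f_res_sols.
have S0 x : x \in S -> x != 0.
  rewrite inE; apply: contraTneq => ->; rewrite rootE horner_coef0 coef_map.
  rewrite -(dvdz_pcharf (pchar_Fp q_prime)).
  by apply: contra f0 => /dvdz_mod0P ->; rewrite mod0z.
have qp : 'X^m + 1 = 'X^m - (-1)%:P :> {poly int} by rewrite rmorphN opprK.
have qm : 'X^m - 1 = 'X^m - 1%:P :> {poly int} by [].
(* This serves both congruences, with [c = 1] for the residues and [c = -1] for the non-residues. *)
have dvd_res (c : int) (B : {set 'F_q}) : {in B, forall x, x \in S /\ x ^+ m = c%:~R} ->
    (res f ('X^m - c%:P) = 0 %[mod q%:Z ^+ #|B|])%Z.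
  move=> SB; rewrite resE.
  have mapg : map_poly intr ('X^m - c%:P) = 'X^m - (c%:~R)%:P :> {poly 'F_q}.
    by rewrite rmorphB /= map_polyXn map_polyC.
  rewrite mod0z; apply/dvdz_mod0P/dvdz_resultant_common_roots => //.
    by rewrite mapg -size_poly_eq0 size_XnsubC.
  move=> x /SB[]; rewrite inE => -> xm.
  by rewrite mapg rootE !hornerE xm subrr eqxx.
rewrite qp qm; split.
- by rewrite (res_XnsubC f_deg m0 _ f_roots).
- rewrite -f_res_sols; apply: dvd_res => x; rewrite inE => /andP[xS xres].
  by rewrite (euler_criterion q_prime q_odd (S0 x xS)) xres.
- rewrite (res_XnsubC f_deg m0 _ f_roots) //.
  by under [in RHS]eq_bigr => i _ do rewrite -[1]opprK.
(* The truncated subtraction is exact, since [b] counts a subset of the [l] solutions. *)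
- have -> : (l - b)%N = #|[set x in S | ~~ quadratic_residue x]|.
    rewrite -f_sols -f_res_sols -(cardsID [set x | quadratic_residue x] S) -setIdE addKn.
    by apply: eq_card => x; rewrite !inE andbC.
  apply: dvd_res => x; rewrite inE => /andP[xS xres].
  by rewrite (euler_criterion q_prime q_odd (S0 x xS)) (negPf xres).
Qed.
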